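(* Let $d\ge 3$ and let $\lambda$ be a positive integer. For all functions $f,g:\mathbb{Z}^d\to[0,\infty)$ one has the pointwise bound on $\mathbb{Z}^d$ $$T_\lambda(f,g) \lesssim \lambda^{1-d/2} A_\lambda(f)\, g + \lambda^{1-d}\sum_{0\le k\le \log_2\lambda} (2^k)^{d/2-1}(\lambda-2^k)^{d/2} A_{\lambda-2^k}(f)\, S^*_{2^k}(g),$$ where $k$ runs over integers.
   Context: $|\cdot|$ is the Euclidean norm. The discrete bilinear spherical average is $$T_\lambda(f,g)(x) = \frac{1}{N(\lambda)} \sum_{\substack{u,v\in\mathbb{Z}^d\\ |u|^2+|v|^2=\lambda}} f(x-u)\,g(x-v),\qquad N(\lambda)=\#\{(u,v)\in\mathbb{Z}^d\times\mathbb{Z}^d:|u|^2+|v|^2=\lambda\}.$$ The ball average is $A_\lambda(f)=f*\mu_\lambda$, where $\mu_\lambda$ is the uniform probability measure on $\{u\in\mathbb{Z}^d: |u|\le\lambda^{1/2}\}$ (so $\mu_\lambda\approx\lambda^{-d/2}\mathbf 1_{\{|u|^2\le\lambda\}}$ for $\lambda \ge 1$). The dyadic maximal spherical average is $$S^*_\Lambda(g)(x) = \sup_{\lambda'\approx\Lambda} (\lambda')^{1-d/2}\sum_{v\in\mathbb{Z}^d,\ |v|^2=\lambda'} g(x-v),$$ where the supremum is over positive integers $\lambda'$ with $\lambda'\approx\Lambda$, meaning $\Lambda\le\lambda'<2\Lambda$. $X\lesssim Y$ means $X\le CY$ with $C$ depending only on $d$ (not on $\lambda$, $f$, $g$ or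 the point).
   Formalization: When λ is a power of 2 and k = log_2 λ, the factor (λ−2^k)^{d/2} is taken to be 1 instead of 0; with 0 the bound fails (x=0, f=1_{0}, g=1_{−v}, |v|²=λ). For all other λ the formula is unchanged. *)

(* Defs.v *)
From HB Require Import structures.
From mathcomp Require Export all_boot all_order all_algebra.
From mathcomp Require Import finmap zify.
From mathcomp Require Export all_classical all_reals all_analysis.

Set Implicit Arguments.
Unset Strict Implicit.
Unset Printing Implicit Defensive.

Import Order.TTheory GRing.Theory Num.Theory.
Local Open Scope classical_set_scope.
Local Open Scope ring_scope.

Notation Zd d := 'rV[int]_d.

(* The library norm on row vectors is the sup norm. *)
Definition enorm (R : realType) (d : nat) (u : Zd d) : R :=
  Num.sqrt (\sum_(i < d) (u 0 i)%:~R ^+ 2).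

Definition zball (R : realType) (d lambda : nat) : set (Zd d) :=
  [set u | enorm R u <= Num.sqrt lambda%:R].

Definition zsphere (R : realType) (d lambda : nat) : set (Zd d) :=
  [set v | enorm R v ^+ 2 = lambda%:R].

Definition zsphere2 (R : realType) (d lambda : nat) : set (Zd d * Zd d) :=
  [set w | enorm R w.1 ^+ 2 + enorm R w.2 ^+ 2 = lambda%:R].

(* [fset_set] of an infinite set is empty, and [\sum_(u \in A)] is 0 on
   infinite supports; neither happens here, as the three lemmas show. *)
Lemma zball_finite (R : realType) (d lambda : nat) :
  finite_set (@zball R d lambda).
Proof.
apply: (@sub_finite_set _ _
  ((fun w : {ffun 'I_d -> 'I_(lambda + lambda).+1} =>
     \row_i ((w i)%:Z - lambda%:Z)) @` setT)); last exact: finite_image.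
move=> u; rewrite /zball/= /enorm ler_sqrt ?ler0n// => hu.
have hi i : `|u 0 i| <= lambda%:Z.
  have hs : (\sum_(j < d) (u 0 j) ^+ 2 : int) <= lambda%:Z.
    rewrite -(ler_int R) rmorph_sum/= (le_trans _ hu)//.
    by rewrite ler_sum// => j _; rewrite rmorphXn.
  have : u 0 i ^+ 2 <= lambda%:Z.
    by apply: le_trans hs; rewrite (bigD1 i)//= lerDl sumr_ge0// => j _; exact: sqr_ge0.
  apply: le_trans; rewrite -real_normK ?num_real// expr2.
  have [->|u0] := eqVneq (u 0 i) 0; first by rewrite normr0 mulr0.
  by rewrite ler_peMr// -gtz0_ge1 normr_gt0.
have hlu i : - lambda%:Z <= u 0 i <= lambda%:Z by rewrite -ler_norml.
have hp i : (`|(u 0 i + lambda%:Z)%R|%N < (lambda + lambda).+1)%N.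
  by move: (u 0 i) (hlu i) => z /andP[]; lia.
exists [ffun i => Ordinal (hp i)] => //.
apply/rowP => i; rewrite !mxE ffunE/=.
by move: (u 0 i) (hlu i) => z /andP[]; lia.
Qed.

Lemma zsphere_finite (R : realType) (d lambda : nat) :
  finite_set (@zsphere R d lambda).
Proof.
apply: sub_finite_set (@zball_finite R d lambda) => u /= hu.
by rewrite /zball/= -hu sqrtr_sqr ger0_norm ?sqrtr_ge0.
Qed.

Lemma zsphere2_finite (R : realType) (d lambda : nat) :
  finite_set (@zsphere2 R d lambda).
Proof.
apply: (@sub_finite_set _ _ (@zball R d lambda `*` @zball R d lambda)); last first.
  by apply: finite_setX; exact: zball_finite.
case=> u v /= huv; split; rewrite /zball/= -huv/=.
  apply: le_trans (_ : Num.sqrt (enorm R u ^+ 2) <= _).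
    by rewrite sqrtr_sqr ler_norm.
  by rewrite ler_wsqrtr// lerDl sqr_ge0.
  apply: le_trans (_ : Num.sqrt (enorm R v ^+ 2) <= _).
    by rewrite sqrtr_sqr ler_norm.
  by rewrite ler_wsqrtr// lerDr sqr_ge0.
Qed.

Definition bilinear_sphere_avg (R : realType) (d lambda : nat)
    (f g : Zd d -> R) (x : Zd d) : R :=
  (#|` fset_set (@zsphere2 R d lambda)|)%:R^-1 *
  \sum_(w \in @zsphere2 R d lambda) (f (x - w.1) * g (x - w.2)).

Definition ball_avg (R : realType) (d lambda : nat)
    (f : Zd d -> R) (x : Zd d) : R :=
  (#|` fset_set (@zball R d lambda)|)%:R^-1 *
  \sum_(u \in @zball R d lambda) f (x - u).

Definition dyadic_max_sphere (R : realType) (d Lambda : nat)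
    (g : Zd d -> R) (x : Zd d) : R :=
  sup [set l%:R `^ (1 - d%:R / 2) * (\sum_(v \in @zsphere R d l) g (x - v))
      | l in [set l : nat | (0 < l)%N /\ (Lambda <= l < 2 * Lambda)%N]].

(* The factor m^(d/2), of the order of the number of lattice points of
   [zball R d m], is read as 1 at m = 0, where the ball is {0}. With the value 0
   there the bound fails whenever lambda is a power of 2: take x = 0, f the
   indicator of {0} and g that of a single v with |v|^2 = lambda. *)
Definition ball_weight (R : realType) (d m : nat) : R :=
  (maxn m 1)%:R `^ (d%:R / 2).

(* Main.v *)
Require Import Defs.
From mathcomp Require Import zify ring lra finmap.
Import Order.TTheory GRing.Theory Num.Theory.
Local Open Scope classical_set_scope.
Local Open Scope ring_scope.

Set Implicit Arguments.
Unset Strict Implicit.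
Unset Printing Implicit Defensive.

(** Write N(l) for the number of pairs (u, v) of lattice points with
    |u|^2 + |v|^2 = l.  In the sum defining T_l(f, g)(x), collect the pairs
    according to the value m = |v|^2.  The term m = 0 is g(x) times a sum of f
    over a sphere, hence at most the sum of f over the ball of square radius l.
    For 2^k <= m < 2^(k+1) the sum of g over the sphere |v|^2 = m is at most
    m^(d/2-1) times the dyadic maximal function, and what remains is the sum of
    f over the disjoint spheres |u|^2 = l - m, all inside the ball of square
    radius l - 2^k.  As a ball of square radius r has O(max(r, 1)^(d/2)) points,
    sums over balls turn into averages, and the claim follows from the lower
    bound N(l) >= c l^(d-1).

    That lower bound is the arithmetic heart of the proof: N(l) is the number
    of representations of l by 2d >= 6 squares.  It is obtained from four
    squares, by an elementary route that avoids modular forms.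

    For n odd, the number of representations of 4n as a sum of four squares of
    positive odd numbers is sigma(n).  With (2i+1)^2 = 4 i(i+1) + 1 this says
    that the coefficient of X^(n-1) in P^4 is sigma(n), where P is the sum of
    the X^(i(i+1)), i >= 0 ([coef_pronic_theta4]).  The identity
    P (P^4)' = 4 P' P^4 yields a recurrence that determines these coefficients
    ([weight_poly_exp4_recurrence]); sigma satisfies the same one
    ([sigma_recurrence]), because a suitable weight is odd under Zagier's
    involution of the solutions of i^2 + 4 d e = 4n + 1 ([zagier_weightN]).

    Multiplication by a Hurwitz half unit turns four odd squares with sum 4n
    into four squares with sum n, so an odd n has at least n representations by
    four squares ([theta4_odd_ge]).  Summing over two further squares, chosen so
    that the remainder is odd and at least n/2, gives at least c n^2
    representations of every n by six squares ([theta6_ge]); each further pair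
    of squares multiplies the count by a constant times n ([theta_add2_ge]). *)

(** * Pronic numbers and the divisor recurrence *)

Definition pronic (x : int) : nat := absz (x * (x + 1)).

Lemma pronicE (x : int) : (pronic x)%:Z = x * (x + 1).
Proof.
rewrite /pronic; case: x => [i|i]; first by rewrite gez0_abs.
rewrite NegzE; have -> : - i.+1%:Z * (- i.+1%:Z + 1) = (i.+1 * i)%N%:Z by rewrite PoszM intS; ring.
by rewrite absz_nat.
Qed.

Lemma pronic_Posz (i : nat) : pronic i = (i * i.+1)%N.
Proof. by apply/eqP; rewrite -eqz_nat pronicE PoszM intS addrC. Qed.

Lemma pronic_Negz (i : nat) : pronic (Negz i) = (i * i.+1)%N.
Proof. by apply/eqP; rewrite -eqz_nat pronicE NegzE PoszM intS; apply/eqP; ring. Qed.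

Lemma leq_pronic (i : nat) : (i <= i * i.+1)%N.
Proof. by rewrite mulnS leq_addr. Qed.

(** The interval from -L to L-1; it is symmetric under x -> -1 - x, which
    exchanges [Posz i] and [Negz i] and preserves [pronic]. *)
Definition signed_below (L : nat) : seq int :=
  [seq Posz i | i <- iota 0 L] ++ [seq Negz i | i <- iota 0 L].

Lemma uniq_signed_below L : uniq (signed_below L).
Proof.
rewrite cat_uniq !map_inj_uniq ?iota_uniq; [|by move=> ? ? []..].
by rewrite andbT /=; apply/hasPn => x /mapP[i _ ->]; apply/negP => /mapP[].
Qed.

Lemma big_signed_below L (F : int -> int) :
  (forall i, F (Negz i) = F (Posz i)) ->
  \sum_(x <- signed_below L) F x = (\sum_(0 <= i < L) F (Posz i)) *+ 2.
Proof.
move=> FN; rewrite /signed_below big_cat !big_map /= mulr2n.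
by rewrite /index_iota subn0; congr (_ + _); apply: eq_bigr => i _; rewrite FN.
Qed.

Lemma sum_perm_invariant (T : eqType) (s : seq T) (phi : T -> T) (w : T -> int) :
    uniq s -> {in s, forall t, phi t \in s} -> {in s, involutive phi} ->
  \sum_(t <- s) w (phi t) = \sum_(t <- s) w t.
Proof.
move=> us phis phiK.
suff phi_perm : perm_eq [seq phi t | t <- s] s.
  by rewrite -[RHS](perm_big _ phi_perm) big_map.
have phi_inj : {in s &, injective phi}.
  by move=> a b sa sb eqab; rewrite -(phiK _ sa) -(phiK _ sb) eqab.
apply: uniq_perm => //; first by rewrite map_inj_in_uniq.
move=> t; apply/mapP/idP => [[u su ->]|st]; first exact: phis.
by exists (phi t); [exact: phis | rewrite phiK].
Qed.

Lemma sum_involution_odd (T : eqType) (s : seq T) (phi : T -> T) (w : T -> int) :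
    uniq s -> {in s, forall t, phi t \in s} -> {in s, involutive phi} ->
  {in s, forall t, w (phi t) = - w t} -> \sum_(t <- s) w t = 0.
Proof.
move=> us phis phiK wphi.
have sumE := sum_perm_invariant w us phis phiK.
rewrite (eq_big_seq (fun t => - w t) wphi) sumrN in sumE.
have /eqP : (\sum_(t <- s) w t) *+ 2 = 0 by rewrite mulr2n -{1}sumE addNr.
by rewrite mulrn_eq0 => /eqP.
Qed.

Definition sigma (m : nat) : int := \sum_(d <- divisors m) d%:Z.

(** With i = 2x+1 these are the solutions of i^2 + 4 d e = 4n + 1 with i odd
    and d, e > 0, the set on which Zagier's involution acts. *)
Definition pronic_triples (n : nat) : seq (int * (nat * nat)) :=
  [seq (x, (d, (n - pronic x) %/ d)%N)
  | x <- [seq x <- signed_below n | (pronic x < n)%N],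
    d <- divisors (n - pronic x)].

Lemma mem_signed_below L x : (pronic x < L)%N -> x \in signed_below L.
Proof.
rewrite mem_cat; case: x => i.
  rewrite pronic_Posz => lti; rewrite map_f // mem_iota /= add0n.
  exact: leq_ltn_trans (leq_pronic i) lti.
rewrite pronic_Negz => lti; rewrite orbC map_f // mem_iota /= add0n.
exact: leq_ltn_trans (leq_pronic i) lti.
Qed.

Lemma mem_pronic_triples n x d e :
  ((x, (d, e)) \in pronic_triples n) =
  [&& (0 < d)%N, (0 < e)%N & (pronic x + d * e == n)%N].
Proof.
apply/allpairsPdep/and3P => [[y [c []]]|[d0 e0 /eqP xden]].
  rewrite mem_filter => /andP[ltyn _]; rewrite -dvdn_divisors ?subn_gt0 //.
  move=> /dvdnP[q nyE] [-> -> ->].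
  have c0 : (0 < c)%N by case: c nyE => [|//]; lia.
  rewrite nyE mulnK //; split => //; first by case: q nyE => [|//]; lia.
  by apply/eqP; lia.
have de0 : (0 < d * e)%N by rewrite muln_gt0 d0.
exists x, d; split.
- have ltx : (pronic x < n)%N by lia.
  by rewrite mem_filter ltx mem_signed_below.
- rewrite -dvdn_divisors; last by lia.
  by rewrite -xden addKn dvdn_mulr.
- by rewrite -xden addKn mulKn.
Qed.

Lemma uniq_pronic_triples n : uniq (pronic_triples n).
Proof.
apply: allpairs_uniq_dep => [|x _|].
- by rewrite filter_uniq // uniq_signed_below.
- exact: divisors_uniq.
by move=> [x d] [y c] _ _ /= [-> -> _].
Qed.

Lemma sum_pronic_triples n (h : nat -> int) :
  \sum_(t <- pronic_triples n) t.2.1%:Z * h (pronic t.1) =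
  \sum_(x <- signed_below n | (pronic x < n)%N) h (pronic x) * sigma (n - pronic x).
Proof.
rewrite /pronic_triples big_allpairs_dep big_filter; apply: eq_bigr => x _.
by rewrite /sigma mulr_sumr; apply: eq_bigr => d _ /=; rewrite mulrC.
Qed.

(** In terms of the odd number i = 2x+1, this is Zagier's map
    (i, d, e) -> (2d - i, d, e + i - d) when e + i > d, and
    (i, d, e) -> (- 2e - i, d - i - e, e) when e + i < d. *)
Definition zagier (t : int * (nat * nat)) : int * (nat * nat) :=
  let: (x, (d, e)) := t in
  if d%:Z < e%:Z + (2 * x + 1)
  then (d%:Z - x - 1, (d, absz (e%:Z + (2 * x + 1) - d%:Z)%R))
  else (- e%:Z - x - 1, (absz (d%:Z - (2 * x + 1) - e%:Z)%R, e)).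

(** Still with i = 2x+1, this is (d + e)(d - i)(e + i).  On the first branch of
    [zagier] put p = e + i - d and q = e: the weight becomes
    (d + q)(q - p)(d + p), while [zagier] exchanges p and q, whence the change of
    sign.  The second branch is conjugate to the first one by the symmetry
    (i, d, e) -> (- i, e, d), which preserves the weight. *)
Definition zagier_weight (t : int * (nat * nat)) : int :=
  let: (x, (d, e)) := t in
  (d%:Z + e%:Z) * (d%:Z - (2 * x + 1)) * (e%:Z + (2 * x + 1)).

Lemma pronic_triple_int x d e n :
  (pronic x + d * e == n)%N = (x * (x + 1) + d%:Z * e%:Z == n%:Z).
Proof. by rewrite -pronicE; lia. Qed.

(** Pronic numbers are even, so d and e are odd when n is odd, and d - e cannot
    be the odd number 2x+1: the two branches of [zagier] exhaust all cases. *)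
Lemma pronic_triple_odd n x d e : odd n -> (x, (d, e)) \in pronic_triples n ->
  d%:Z != e%:Z + (2 * x + 1).
Proof.
move=> on; rewrite mem_pronic_triples => /and3P[_ _ /eqP xden].
have : ~~ odd (pronic x).
  by case: x {xden} => i; rewrite ?pronic_Posz ?pronic_Negz oddM /= andbN.
move: on; rewrite -xden oddD oddM.
case od: (odd d); case oe: (odd e); rewrite /= ?addbF => h1 h2; try by rewrite h1 in h2.
lia.
Qed.

Lemma zagier_stable n : odd n ->
  {in pronic_triples n, forall t, zagier t \in pronic_triples n}.
Proof.
move=> on [x [d e]] tn; have neq := pronic_triple_odd on tn; move: tn.
rewrite /zagier; case: ltP => cmp; rewrite !mem_pronic_triples !pronic_triple_int.
- move=> /and3P[d0 e0 /eqP xden]; rewrite d0 absz_gt0 subr_eq0 eq_sym neq.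
  rewrite gez0_abs; last by lia.
  by apply/eqP; rewrite -xden; ring.
- move=> /and3P[d0 e0 /eqP xden]; rewrite e0 absz_gt0 subr_eq0 subr_eq neq.
  rewrite gez0_abs; last by lia.
  by apply/eqP; rewrite -xden; ring.
Qed.

Lemma zagierK n : odd n -> {in pronic_triples n, involutive zagier}.
Proof.
move=> on [x [d e]] tn; have neq := pronic_triple_odd on tn.
move: tn; rewrite mem_pronic_triples => /and3P[d0 e0 _].
rewrite /zagier; case: ltP => cmp; case: ltP => cmp'; try lia;
  congr (_, (_, _)); lia.
Qed.

Lemma zagier_weightN n : odd n ->
  {in pronic_triples n, forall t, zagier_weight (zagier t) = - zagier_weight t}.
Proof.
move=> on [x [d e]] _; rewrite /zagier; case: ltP => cmp; rewrite /zagier_weight.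
- by rewrite gez0_abs; [ring | lia].
- by rewrite gez0_abs; [ring | lia].
Qed.

Lemma sum_zagier_weight n : odd n ->
  \sum_(t <- pronic_triples n) zagier_weight t = 0.
Proof.
move=> on; apply: (sum_involution_odd (phi := zagier)).
- exact: uniq_pronic_triples.
- exact: zagier_stable.
- exact: zagierK.
- exact: zagier_weightN.
Qed.

Lemma pronic_opp x : pronic (- x - 1) = pronic x.
Proof. by apply/eqP; rewrite -eqz_nat !pronicE; apply/eqP; ring. Qed.

(** The part of the weight that is even in i = 2x+1 is
    (d + e)(d e - i^2), and d e - i^2 = n - 1 - 5 x(x+1) on the solutions;
    exchanging d and e then replaces d + e by 2 d. *)
Lemma sum_divisor_pronic_triples n : odd n ->
  \sum_(t <- pronic_triples n)
    t.2.1%:Z * ((n%:Z - 1) - 5 * (pronic t.1)%:Z) = 0.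
Proof.
move=> on.
pose flip (t : int * (nat * nat)) := (- t.1 - 1, t.2).
pose swap (t : int * (nat * nat)) := (t.1, (t.2.2, t.2.1)).
pose v (t : int * (nat * nat)) : int :=
  (t.2.1%:Z + t.2.2%:Z) * (n%:Z - 1 - 5 * (pronic t.1)%:Z).
have us := uniq_pronic_triples n.
have v0 : \sum_(t <- pronic_triples n) v t = 0.
  have : (\sum_(t <- pronic_triples n) v t) *+ 2 = 0.
    rewrite -sumrMnl.
    have -> : \sum_(t <- pronic_triples n) v t *+ 2 =
        \sum_(t <- pronic_triples n) (zagier_weight t + zagier_weight (flip t)).
      apply: eq_big_seq => -[x [d e]].
      rewrite mem_pronic_triples pronic_triple_int => /and3P[_ _ /eqP xden].
      by rewrite /v /flip /zagier_weight /= pronicE -xden; ring.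
    rewrite big_split /= (@sum_perm_invariant _ _ flip zagier_weight us).
    - by rewrite sum_zagier_weight.
    - by move=> [x [d e]]; rewrite !mem_pronic_triples pronic_opp.
    - by move=> [x [d e]] _; rewrite /flip /=; congr (_, _); ring.
  by move/eqP; rewrite mulrn_eq0 => /eqP.
have swapE : \sum_(t <- pronic_triples n)
    t.2.2%:Z * ((n%:Z - 1) - 5 * (pronic t.1)%:Z) =
  \sum_(t <- pronic_triples n)
    t.2.1%:Z * ((n%:Z - 1) - 5 * (pronic t.1)%:Z).
  rewrite -(@sum_perm_invariant _ _ swap _ us) //=.
  - move=> [x [d e]]; rewrite !mem_pronic_triples mulnC.
    by case: (0 < e)%N; case: (0 < d)%N.
  - by case=> x [d e].
move: v0; rewrite /v; under eq_bigr => t _ do rewrite mulrDl.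
rewrite big_split /= swapE -mulr2n => /eqP.
by rewrite mulrn_eq0 => /eqP.
Qed.

Lemma sigma_recurrence n L : odd n -> (n <= L)%N ->
  \sum_(0 <= i < L | (i * i.+1 < n)%N)
    ((n%:Z - 1) - 5 * (i * i.+1)%N%:Z) * sigma (n - i * i.+1) = 0.
Proof.
move=> on leqnL.
have -> : \sum_(0 <= i < L | (i * i.+1 < n)%N)
    ((n%:Z - 1) - 5 * (i * i.+1)%N%:Z) * sigma (n - i * i.+1) =
  \sum_(0 <= i < n | (i * i.+1 < n)%N)
    ((n%:Z - 1) - 5 * (i * i.+1)%N%:Z) * sigma (n - i * i.+1).
  rewrite [RHS](big_nat_widen _ _ _ _ _ leqnL); apply: eq_bigl => i.
  by case: ltnP => //= /(leq_ltn_trans (leq_pronic i)) ->.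
have := sum_divisor_pronic_triples on.
rewrite (sum_pronic_triples n (fun m => (n%:Z - 1) - 5 * m%:Z)) big_mkcond /=.
rewrite big_signed_below; last by move=> i; rewrite pronic_Negz pronic_Posz.
move/eqP; rewrite mulrn_eq0 => /eqP /(etrans _); apply.
by rewrite big_mkcond; apply: eq_bigr => i _; rewrite pronic_Posz.
Qed.

(** * Generating polynomials *)

Definition weight_poly (T : Type) (s : seq T) (e : T -> nat) : {poly int} :=
  \sum_(x <- s) 'X^(e x).

Lemma coef_weight_poly T (s : seq T) e n :
  (weight_poly s e)`_n = (count (fun x => e x == n) s)%:R.
Proof.
rewrite /weight_poly coef_sum -sum1_count natr_sum [RHS]big_mkcond /=.
by apply: eq_bigr => x _; rewrite coefXn eq_sym; case: eqP.
Qed.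

Lemma coef_weight_polyM T (s : seq T) e (p : {poly int}) n :
  (weight_poly s e * p)`_n = \sum_(x <- s | (e x <= n)%N) p`_(n - e x).
Proof.
rewrite /weight_poly mulr_suml coef_sum [RHS]big_mkcond /=.
by apply: eq_bigr => x _; rewrite coefXnM ltnNge; case: leqP.
Qed.

Definition pairs (T : Type) (s : seq T) : seq (T * T) :=
  [seq (x, y) | x <- s, y <- s].

Lemma weight_poly_sqr T (s : seq T) e :
  weight_poly s e ^+ 2 = weight_poly (pairs s) (fun p => (e p.1 + e p.2)%N).
Proof.
rewrite /weight_poly big_allpairs_dep expr2 mulr_suml; apply: eq_bigr => x _.
by rewrite mulr_sumr; apply: eq_bigr => y _; rewrite exprD.
Qed.

(** Compare coefficients in P (X (P^4)') = 4 (X P') P^4.  The left-hand side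
    gives each term the weight n - e x, the right-hand side 4 e x. *)
Lemma weight_poly_exp4_recurrence T (s : seq T) e n :
  \sum_(x <- s | (e x <= n)%N)
    (n%:Z - 5 * (e x)%:Z) * (weight_poly s e ^+ 4)`_(n - e x) = 0.
Proof.
set P := weight_poly s e.
have XP : 'X * P^`() = \sum_(x <- s) (e x)%:Z *: 'X^(e x).
  rewrite /P /weight_poly raddf_sum mulr_sumr; apply: eq_bigr => x _.
  rewrite /= derivXn; case: (e x) => [|m]; first by rewrite mulr0n mulr0 scale0r.
  by rewrite mulrnAr -exprS -natz scaler_nat.
have coefXder (p : {poly int}) m : ('X * p^`())`_m = m%:Z * p`_m.
  by rewrite coefXM coef_deriv; case: m => [|m]; rewrite ?mul0r //= -natz mulr_natl.
have derE : P * ('X * (P ^+ 4)^`()) = 4 *: ('X * P^`() * P ^+ 4).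
  by rewrite deriv_exp scaler_nat; ring.
rewrite big_mkcond; have := congr1 (fun p : {poly int} => p`_n) derE.
rewrite coef_weight_polyM coefZ XP mulr_suml coef_sum mulr_sumr [LHS]big_mkcond /=.
move/eqP; rewrite -subr_eq0 -sumrB => /eqP /(etrans _); apply.
apply: eq_bigr => x _; rewrite -scalerAl coefZ coefXnM ltnNge.
case: leqP => lexn /=; last by rewrite !mulr0 subr0.
by rewrite coefXder -subzn //; ring.
Qed.

Lemma coef0_exp (p : {poly int}) k : (p ^+ k)`_0 = p`_0 ^+ k.
Proof. by elim: k => [|k IH]; rewrite ?coefC // !exprS coef0M IH. Qed.

(** * Sums of four odd squares *)

Definition pronic_theta (L : nat) : {poly int} :=
  weight_poly (iota 0 L) (fun i => i * i.+1)%N.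

Lemma sigma1 : sigma 1 = 1.
Proof. by rewrite /sigma big_cons big_nil. Qed.

Lemma sigma_ge n : (0 < n)%N -> n%:Z <= sigma n.
Proof.
move=> n0; rewrite /sigma (big_rem n) -?dvdn_divisors //=.
by rewrite lerDl sumr_ge0.
Qed.

(** Both sides satisfy the same recurrence, in which the index i = 0
    contributes m times the unknown coefficient and every other index refers to
    a smaller even number m - i(i+1).  Hence induction on m, started at m = 0
    where this leading factor vanishes. *)
Lemma coef_pronic_theta4 L m : (m < L)%N -> ~~ odd m ->
  (pronic_theta L ^+ 4)`_m = sigma m.+1.
Proof.
elim/ltn_ind: m => m IH ltmL em.
case: m => [|m] in IH ltmL em *.
  rewrite coef0_exp sigma1 coef_weight_poly -{2}(expr1n _ 4); congr (_ ^+ 4).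
  case: L ltmL {IH} => // L _; rewrite /= (eq_in_count (a2 := pred0)).
    by rewrite count_pred0 addn0.
  move=> i; rewrite mem_iota => /andP[i0 _].
  by rewrite muln_eq0 orbF; case: i i0.
have om : odd m.+2 by exact: em.
have := sigma_recurrence om ltmL.
have := weight_poly_exp4_recurrence (iota 0 L) (fun i => i * i.+1)%N m.+1.
rewrite -/(pronic_theta L) /index_iota subn0.
case: L => // L in IH ltmL *.
rewrite /= !big_cons /= !mul0n !subn0 !mulr0 !subr0 => pE sE.
have : (m.+1%:Z) * (pronic_theta L.+1 ^+ 4)`_m.+1 = m.+1%:Z * sigma m.+2.
  apply: (@addIr _ (\sum_(j <- iota 1 L | (j * j.+1 <= m.+1)%N)
      (m.+1%:Z - 5 * (j * j.+1)%N%:Z) * (pronic_theta L.+1 ^+ 4)`_(m.+1 - j * j.+1))).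
  rewrite pE -[LHS]sE; congr (_ + _).
  clear pE sE; rewrite big_seq_cond [RHS]big_seq_cond; apply: eq_big => [j|j /andP[]]; first by [].
  rewrite mem_iota ltnS => /andP[j0 _] lej; rewrite IH.
  - by rewrite -subSn //; congr (_ * _); rewrite [m.+2%:Z]intS; ring.
  - by case: j j0 lej => // j _ lej; rewrite mulSn; lia.
  - by apply: leq_ltn_trans ltmL; rewrite leq_subr.
  - by rewrite oddB // (negbTE em) oddM /= andbN.
by move/mulfI; apply.
Qed.

(** * Sums of four squares *)

(** The coefficient of X^n in a power of [theta L] counts representations by
    squares of elements of [signed_below L], hence all of them when n < L. *)
Definition theta (L : nat) : {poly int} :=
  weight_poly (signed_below L) (fun x => absz x ^ 2)%N.

(** Let A, B, C, D be the odd numbers 2a+1, 2b+1, 2c+1, 2z+1, where z is d or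
    -1-d; the latter changes D into -D, and the choice makes A + B + C + D
    divisible by 4.  The result consists of
    (A + B + C + D)/4, (A + B - C - D)/4, (A - B + C - D)/4 and
    (A - B - C + D)/4, written in terms of the half y of a + b + c + z.
    This is, up to scaling, an orthogonal transformation, so that a sum of
    squares 4n becomes n. *)
Definition half_unit (q : (nat * nat) * (nat * nat)) : (int * int) * (int * int) :=
  let: ((a, b), (c, d)) := q in
  let s := (a + b + c + d)%N in
  let z := (if odd s then Negz d else Posz d) in
  let y := (s./2%:Z - (if odd s then d%:Z else 0))%R in
  ((y + 1, y - c%:Z - z), (y - b%:Z - z, y - b%:Z - c%:Z)).

Lemma half_unit_inj : injective half_unit.
Proof.
move=> [[a b] [c d]] [[a' b'] [c' d']] /=.
have sE := odd_double_half (a + b + c + d); move: sE.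
have sE' := odd_double_half (a' + b' + c' + d'); move: sE'.
set h := (a + b + c + d)./2; set h' := (a' + b' + c' + d')./2.
case: (odd (a + b + c + d)); case: (odd (a' + b' + c' + d')) => /= E E';
  rewrite ?NegzE => -[E1 E2 E3 E4];
  by congr ((_, _), (_, _)); lia.
Qed.

Lemma sqr_abszE (x : int) : (absz x ^ 2)%N%:Z = x ^+ 2.
Proof. by rewrite -mulnn PoszM abszE -expr2 real_normK ?num_real. Qed.

Lemma half_unit_norm q n :
  (q.1.1 * q.1.1.+1 + q.1.2 * q.1.2.+1 +
   (q.2.1 * q.2.1.+1 + q.2.2 * q.2.2.+1) == n)%N ->
  (absz (half_unit q).1.1 ^ 2 + absz (half_unit q).1.2 ^ 2 +
   (absz (half_unit q).2.1 ^ 2 + absz (half_unit q).2.2 ^ 2) = n.+1)%N.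
Proof.
case: q => [[a b] [c d]] /= /eqP <-; apply/eqP; rewrite -eqz_nat; apply/eqP.
rewrite !PoszD !sqr_abszE intS !PoszD !PoszM !intS /=.
have := odd_double_half (a + b + c + d).
set h := (a + b + c + d)./2; case: (odd _) => sE; rewrite ?NegzE ?intS.
- have -> : a%:Z = 2 * h%:Z + 1 - b%:Z - c%:Z - d%:Z by lia.
  by clear sE; move: (Posz h) (Posz b) (Posz c) (Posz d) => {}h {}b {}c {}d; ring.
- have -> : a%:Z = 2 * h%:Z - b%:Z - c%:Z - d%:Z by lia.
  by clear sE; move: (Posz h) (Posz b) (Posz c) (Posz d) => {}h {}b {}c {}d; ring.
Qed.

Lemma mem_signed_below_sqr L x : (absz x ^ 2 < L)%N -> x \in signed_below L.
Proof.
move=> ltx; have {}ltx : (absz x < L)%N.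
  by apply: leq_ltn_trans ltx; case: (absz x) => // k; rewrite leq_pmulr.
rewrite mem_cat; case: x ltx => i ltx; first by rewrite map_f // mem_iota.
by rewrite orbC map_f // mem_iota /=; apply: ltnW.
Qed.

Lemma mem_pairs (T : eqType) (s : seq T) x y :
  ((x, y) \in pairs s) = (x \in s) && (y \in s).
Proof.
apply/allpairsP/andP => [[[a b] /= [sa sb [-> ->]]]|[sx sy]]; first by [].
by exists (x, y).
Qed.

Lemma uniq_pairs (T : eqType) (s : seq T) : uniq s -> uniq (pairs s).
Proof. by move=> us; apply: allpairs_uniq => // -[? ?] [? ?] _ _. Qed.

Lemma weight_poly_exp4 T (s : seq T) e :
  weight_poly s e ^+ 4 = weight_poly (pairs (pairs s))
    (fun q => (e q.1.1 + e q.1.2 + (e q.2.1 + e q.2.2))%N).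
Proof. by rewrite (exprM _ 2 2) !weight_poly_sqr. Qed.

(** [half_unit] maps the representations of 4n by positive odd squares
    injectively to representations of n; the former are counted by
    [coef_pronic_theta4], and sigma(n) >= n. *)
Lemma theta4_odd_ge L n : odd n -> (n < L)%N -> n%:Z <= (theta L ^+ 4)`_n.
Proof.
case: n => // n on ltnL; apply: (le_trans (sigma_ge (ltn0Sn n))).
rewrite -(@coef_pronic_theta4 L) //; last exact: ltnW.
rewrite /pronic_theta /theta !weight_poly_exp4 !coef_weight_poly ler_nat.
rewrite -!size_filter -(size_map half_unit).
apply: uniq_leq_size.
  rewrite map_inj_uniq; last exact: half_unit_inj.
  by rewrite filter_uniq // !uniq_pairs // iota_uniq.
move=> t /mapP[q]; rewrite mem_filter => /andP[/half_unit_norm qn _] ->.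
move: qn; case: (half_unit q) => [[x y] [z w]] /= qn.
rewrite mem_filter !mem_pairs /= qn eqxx /=.
by rewrite !mem_signed_below_sqr //; lia.
Qed.

(** * Six and more squares *)

Lemma big_subset_ge (T : eqType) (r l : seq T) (P : pred T) (F : T -> int) :
    uniq r -> uniq l -> {subset r <= l} -> {in r, forall x, P x} ->
    (forall x, 0 <= F x) ->
  \sum_(x <- r) F x <= \sum_(x <- l | P x) F x.
Proof.
move=> ur ul rl rP F0; rewrite [leRHS](bigID (mem r)) /=.
have rE : perm_eq r [seq x <- l | P x && (x \in r)].
  apply: uniq_perm => [//||x]; first by rewrite filter_uniq.
  rewrite mem_filter; case xr: (x \in r); last by rewrite andbF.
  by rewrite rP // rl.
by rewrite (perm_big _ rE) big_filter lerDl sumr_ge0.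
Qed.

Lemma coef_weight_poly_exp_ge0 T (s : seq T) e k n : 0 <= (weight_poly s e ^+ k)`_n.
Proof.
elim: k n => [|k IH] n; first by rewrite coefC; case: ifP.
by rewrite exprS coef_weight_polyM sumr_ge0.
Qed.

(** Two squares are split off, with roots restricted to chosen injective
    families f and g for which the remainder is under control. *)
Lemma theta_sqrM_ge L n s (f g : nat -> nat) (p : {poly int}) (c : int) :
    (n < L)%N -> injective f -> injective g -> (forall m, 0 <= p`_m) ->
    (forall i j, (i < s)%N -> (j < s)%N ->
       (f i ^ 2 + g j ^ 2 <= n)%N /\ c <= p`_(n - (f i ^ 2 + g j ^ 2))) ->
  (s ^ 2)%N%:Z * c <= (theta L ^+ 2 * p)`_n.
Proof.
move=> ltnL finj ginj p0 H.
rewrite /theta weight_poly_sqr coef_weight_polyM.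
pose r : seq (int * int) := [seq (Posz (f i), Posz (g j)) | i <- iota 0 s, j <- iota 0 s].
have rP q : q \in r -> (absz q.1 ^ 2 + absz q.2 ^ 2 <= n)%N /\
    c <= p`_(n - (absz q.1 ^ 2 + absz q.2 ^ 2)).
  move=> /allpairsP[[i j]] [] /=; rewrite !mem_iota /= => lti ltj ->.
  exact: H.
apply: (@le_trans _ _ (\sum_(q <- r) p`_(n - (absz q.1 ^ 2 + absz q.2 ^ 2)))).
  apply: (@le_trans _ _ (\sum_(q <- r) c)); last first.
    by rewrite big_seq [leRHS]big_seq; apply: ler_sum => q /rP[].
  rewrite big_const_seq count_predT size_allpairs !size_iota iter_addr_0.
  by rewrite -mulr_natl mulnn natz.
apply: big_subset_ge => //.
- apply: allpairs_uniq; rewrite ?iota_uniq //.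
  by move=> [i j] [i' j'] _ _ /= [/finj -> /ginj ->].
- by rewrite uniq_pairs // uniq_signed_below.
- move=> [x y] /rP[/= xy _]; rewrite mem_pairs.
  by rewrite !mem_signed_below_sqr //; lia.
- by move=> q /rP[].
Qed.

Lemma scaled_floor_sqrt k n : (0 < k)%N ->
  exists s, (k * s ^ 2 <= n)%N /\ (n < k * s.+1 ^ 2)%N.
Proof.
move=> k0; pose P s := (k * s ^ 2 <= n)%N.
have P0 : exists s, P s by exists 0%N; rewrite /P muln0.
have Pn s : P s -> (s <= n)%N.
  move=> /(leq_trans _); apply; apply: (@leq_trans (s ^ 2)); last exact: leq_pmull.
  by case: s => // s; rewrite -mulnn leq_pmulr.
case: (ex_maxnP P0 Pn) => s Ps maxs; exists s; split => //.
by rewrite ltnNge; apply/negP => /maxs; rewrite ltnn.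
Qed.

(** The roots 2i and 2j + [n even] with i, j <= s make the remainder odd.  The
    constant 26 comes from 8s^2 + 4s + 1 <= 13s^2 for s >= 1, which keeps the
    remainder at least n/2 as soon as 26s^2 <= n; for s = 0 this is checked
    directly. *)
Lemma theta6_ge L n : (0 < n)%N -> (n < L)%N ->
  (n ^ 2)%N%:Z <= 52 * (theta L ^+ 6)`_n.
Proof.
move=> n0 ltnL; have [s [les lts]] := @scaled_floor_sqrt 26 n isT.
have := @theta_sqrM_ge L n s.+1 (fun i => i.*2) (fun j => j.*2 + ~~ odd n)%N
   (theta L ^+ 4) (uphalf n)%:Z ltnL.
rewrite -exprD => main.
have : (s.+1 ^ 2)%N%:Z * (uphalf n)%:Z <= (theta L ^+ 6)`_n.
  apply: main => [i j|i j|m|i j lti ltj].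
  - by move/double_inj.
  - by move/addIn/double_inj.
  - exact: coef_weight_poly_exp_ge0.
  have sum_le : (uphalf n + (i.*2 ^ 2 + (j.*2 + ~~ odd n) ^ 2) <= n)%N.
    have ii : (i * i <= s * s)%N by rewrite leq_mul.
    have jj : (j * j <= s * s)%N by rewrite leq_mul.
    have ss : (s <= s * s)%N by case: (s) => // k; rewrite leq_pmulr.
    have := odd_double_half n; rewrite uphalf_half; move: les; rewrite -!mulnn -!muln2.
    have -> : (i * 2 * (i * 2) = 4 * (i * i))%N by ring.
    case: (odd n) => /=; rewrite ?addn0.
      have -> : (j * 2 * (j * 2) = 4 * (j * j))%N by ring.
      lia.
    have -> : ((j * 2 + 1) * (j * 2 + 1) = 4 * (j * j) + 4 * j + 1)%N by ring.
    lia.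
  split; first lia.
  apply: (@le_trans _ _ (n - (i.*2 ^ 2 + (j.*2 + ~~ odd n) ^ 2))%N%:Z).
    by rewrite lez_nat; lia.
  apply: theta4_odd_ge; last by apply: leq_ltn_trans ltnL; exact: leq_subr.
  rewrite oddB; last by lia.
  by rewrite oddD !oddX /= oddD !odd_double /= oddb; case: (odd n).
have n_half : (n <= 2 * uphalf n)%N.
  by have := odd_double_half n; rewrite uphalf_half; lia.
have : (n ^ 2 <= 52 * (s.+1 ^ 2 * uphalf n))%N.
  rewrite -mulnn (_ : 52 = 26 * 2)%N // mulnACA.
  by rewrite leq_mul // ltnW.
rewrite -lez_nat !PoszM => /le_trans + coef_ge; apply.
by rewrite ler_pM2l.
Qed.

(** With s the integer part of the square root of n/4, the (s+1)^2 > n/4 pairs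
    of roots i, j <= s leave a remainder at least n/2. *)
Lemma theta_add2_ge C j L n : (0 < n)%N -> (n < L)%N ->
    (forall m, (0 < m)%N -> (m < L)%N ->
      (m ^ j)%N%:Z <= C%:Z * (theta L ^+ (2 * j.+1))`_m) ->
  (n ^ j.+1)%N%:Z <= (4 * 2 ^ j * C)%N%:Z * (theta L ^+ (2 * j.+2))`_n.
Proof.
move=> n0 ltnL IH; have [s [les lts]] := @scaled_floor_sqrt 4 n isT.
have main := @theta_sqrM_ge L n s.+1 id id
   ((2 ^ j * C)%N%:Z *: theta L ^+ (2 * j.+1)) (n ^ j)%N%:Z ltnL.
have : (s.+1 ^ 2)%N%:Z * (n ^ j)%N%:Z <=
    (2 ^ j * C)%N%:Z * (theta L ^+ (2 * j.+2))`_n.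
  rewrite (mulnS 2 j.+1) exprD -coefZ scalerAr; apply: main => // [m|i k lti ltk].
    by rewrite coefZ mulr_ge0 // coef_weight_poly_exp_ge0.
  have ii : (i * i <= s * s)%N by rewrite leq_mul.
  have kk : (k * k <= s * s)%N by rewrite leq_mul.
  move: les; rewrite -!mulnn => les; split; first lia.
  have res : (n <= 2 * (n - (i * i + k * k)))%N by lia.
  have res0 : (0 < n - (i * i + k * k))%N by lia.
  move: (n - _)%N res res0 (leq_subr (i * i + k * k) n) => m res m0 lemn.
  apply: (@le_trans _ _ (2 ^ j * m ^ j)%N%:Z).
    by rewrite lez_nat -expnMn; case: (j) => // j'; rewrite leq_exp2r.
  rewrite coefZ !PoszM -mulrA ler_pM2l ?ltz_nat ?expn_gt0 //.
  by apply: IH => //; exact: leq_ltn_trans lemn ltnL.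
move=> coef_ge; apply: (@le_trans _ _ ((4 * s.+1 ^ 2) * n ^ j)%N%:Z).
  by rewrite lez_nat expnS leq_mul // ltnW.
by rewrite -2!mulnA !(PoszM 4) -mulrA ler_pM2l // PoszM.
Qed.

Lemma theta_even_exp_ge j : (3 <= j)%N -> exists2 C : nat, (0 < C)%N &
  forall L n, (0 < n)%N -> (n < L)%N ->
    (n ^ j.-1)%N%:Z <= C%:Z * (theta L ^+ (2 * j))`_n.
Proof.
case: j => [|[|[|j]]] // _; elim: j => [|j [C C0 IH]].
  by exists 52 => // L n n0 ltnL; exact: theta6_ge.
exists (4 * 2 ^ j.+2 * C)%N => [|L n n0 ltnL].
  by rewrite 2!muln_gt0 expn_gt0.
by apply: theta_add2_ge => // m m0 ltmL; exact: IH.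
Qed.

(** * Lattice points of spheres and balls *)

Definition sqnorm (d : nat) (u : Zd d) : nat := (\sum_(i < d) absz (u 0%R i) ^ 2)%N.

Definition int_rows (L d : nat) : seq (Zd d) :=
  let s := signed_below L in
  [seq \row_j nth 0 s (h j)
  | h : {ffun 'I_d -> 'I_(size s)} <- enum {ffun 'I_d -> 'I_(size s)}].

Lemma uniq_int_rows L d : uniq (int_rows L d).
Proof.
rewrite map_inj_uniq ?enum_uniq // => h h' eqh; apply/ffunP => j; apply: val_inj.
have := congr1 (fun u : Zd d => u 0 j) eqh; rewrite !mxE => /eqP.
by rewrite nth_uniq // ?uniq_signed_below // => /eqP.
Qed.

Lemma theta_exp_rows L d : theta L ^+ d = weight_poly (int_rows L d) (@sqnorm d).
Proof.
rewrite /theta /weight_poly (big_nth 0) big_mkord.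
have -> : forall P : {poly int}, P ^+ d = \prod_(j < d) P.
  by move=> P; rewrite prodr_const card_ord.
rewrite bigA_distr_bigA /= big_map big_enum /=; apply: eq_bigr => h _.
rewrite /sqnorm -(big_morph _ (@exprD _ 'X) (expr0 'X)); congr ('X^_).
by apply: eq_bigr => j _; rewrite mxE.
Qed.

Lemma sqnormE (R : realType) d (u : Zd d) : \sum_(i < d) (u 0 i)%:~R ^+ 2 = (sqnorm u)%:R :> R.
Proof.
rewrite natr_sum; apply: eq_bigr => i _.
by rewrite -[RHS]/((absz (u 0%R i) ^ 2)%N%:Z%:~R) sqr_abszE rmorphXn.
Qed.

Lemma enorm_sqr (R : realType) d (u : Zd d) : enorm R u ^+ 2 = (sqnorm u)%:R.
Proof. by rewrite /enorm sqnormE sqr_sqrtr. Qed.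

Lemma zballE (R : realType) d m (u : Zd d) : zball R m u <-> (sqnorm u <= m)%N.
Proof. by rewrite /zball /= /enorm sqnormE ler_sqrt ?ler0n // ler_nat. Qed.

Lemma zsphereE (R : realType) d l (u : Zd d) : zsphere R l u <-> (sqnorm u == l)%N.
Proof.
rewrite /zsphere /= enorm_sqr -(eqr_nat R).
by split => [->|/eqP].
Qed.

Lemma zsphere2E (R : realType) d l (w : Zd d * Zd d) :
  zsphere2 R l w <-> (sqnorm w.1 + sqnorm w.2 == l)%N.
Proof.
rewrite /zsphere2 /= !enorm_sqr -natrD -(eqr_nat R).
by split => [->|/eqP].
Qed.

Lemma perm_fset_set (T : choiceType) (A : set T) (r : seq T) (P : pred T) :
    uniq r -> (forall x, A x <-> x \in r /\ P x) ->
  finite_set A /\ perm_eq (fset_set A) [seq x <- r | P x].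
Proof.
move=> ur AP.
have finA : finite_set A.
  apply: (@sub_finite_set _ _ [set` r]); last exact: finite_seq.
  by move=> x /AP[].
split=> //; apply: uniq_perm; rewrite ?fset_uniq ?filter_uniq // => x.
rewrite in_fset_set // mem_filter; apply/idP/idP.
  by move=> /set_mem/AP[-> ->].
by move=> /andP[Px rx]; apply/mem_set/AP.
Qed.

Lemma fsbig_seq_filter (R : nmodType) (T : choiceType) (A : set T) (r : seq T)
    (P : pred T) (F : T -> R) :
    uniq r -> (forall x, A x <-> x \in r /\ P x) ->
  \sum_(x \in A) F x = \sum_(x <- r | P x) F x.
Proof.
move=> ur /(perm_fset_set ur)[finA permA].
by rewrite fsbig_finite // (perm_big _ permA) big_filter.
Qed.

Lemma card_zsphere2_ge (R : realType) (d L l : nat) :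
  (theta L ^+ (2 * d))`_l <= (#|` fset_set (@zsphere2 R d l)|)%:Z.
Proof.
rewrite mulnC exprM theta_exp_rows weight_poly_sqr coef_weight_poly natz lez_nat.
rewrite -size_filter; apply: uniq_leq_size.
  by rewrite filter_uniq // uniq_pairs // uniq_int_rows.
move=> w; rewrite mem_filter => /andP[wl _].
by rewrite in_fset_set; [apply/mem_set/zsphere2E | exact: zsphere2_finite].
Qed.

Lemma card_zball_gt0 (R : realType) (d m : nat) :
  (0 < #|` fset_set (@zball R d m)|)%N.
Proof.
rewrite lt0n cardfs_eq0; apply/fset0Pn; exists 0.
rewrite in_fset_set; last exact: zball_finite.
by apply/mem_set/zballE; rewrite /sqnorm big1 // => i _; rewrite mxE.
Qed.

Lemma card_zball_le_cube (R : realType) (d m s : nat) : (m < s.+1 ^ 2)%N ->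
  (#|` fset_set (@zball R d m)| <= (2 * s).+1 ^ d)%N.
Proof.
move=> lts.
pose r := [seq \row_j ((h j)%:Z - s%:Z) : Zd d
  | h : {ffun 'I_d -> 'I_(2 * s).+1} <- enum {ffun 'I_d -> 'I_(2 * s).+1}].
have <- : size r = ((2 * s).+1 ^ d)%N.
  by rewrite size_map -cardE card_ffun !card_ord.
apply: uniq_leq_size => [|u]; first exact: fset_uniq.
rewrite in_fset_set; last exact: zball_finite.
move=> /set_mem/zballE um.
have ui j : (absz (u 0%R j) <= s)%N.
  rewrite leqNgt; apply/negP => ltsu; move: lts; rewrite ltnNge => /negP; apply.
  apply: leq_trans um; rewrite /sqnorm (bigD1 j) //=.
  by apply: leq_trans (leq_addr _ _); rewrite leq_sqr.
have up j : (absz (u 0 j + s%:Z)%R < (2 * s).+1)%N.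
  by move: (u 0 j) (ui j) => z; lia.
apply/mapP; exists [ffun j => Ordinal (up j)]; first by rewrite mem_enum.
apply/rowP => j; rewrite !mxE ffunE /=.
by move: (u 0 j) (ui j) => z; lia.
Qed.

(** If s is the integer part of the square root of m, the ball lies in the cube
    of side 2s+1, and 2s+1 <= 3 max(m, 1)^(1/2). *)
Lemma card_zball_le (R : realType) (d m : nat) :
  (#|` fset_set (@zball R d m)|)%:R <= 3 ^+ d * ball_weight R d m.
Proof.
have [s [les lts]] := @scaled_floor_sqrt 1 m isT; rewrite !mul1n in les lts.
have -> : ball_weight R d m = Num.sqrt (maxn m 1)%:R ^+ d.
  by rewrite /ball_weight mulrC powRrM powR12_sqrt // powR_mulrn // sqrtr_ge0.
rewrite -exprMn; apply: (@le_trans _ _ ((2 * s).+1%:R ^+ d)).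
  by rewrite -natrX ler_nat; exact: card_zball_le_cube.
apply: lerXn2r; rewrite ?nnegrE ?ler0n ?mulr_ge0 ?sqrtr_ge0 //.
rewrite -(@ler_pXn2r _ 2) ?nnegrE ?ler0n ?mulr_ge0 ?sqrtr_ge0 //.
rewrite exprMn sqr_sqrtr ?ler0n // -!natrX -natrM ler_nat -!mulnn.
have ss : (s <= s * s)%N by case: (s) => // k; rewrite leq_pmulr.
have -> : ((2 * s).+1 * (2 * s).+1 = 4 * (s * s) + 4 * s + 1)%N by ring.
rewrite -mulnn in les; lia.
Qed.

Lemma card_zsphere2_powR (R : realType) (d : nat) : (3 <= d)%N ->
  exists2 C : R, 0 < C & forall l, (0 < l)%N ->
    (#|` fset_set (@zsphere2 R d l)|)%:R^-1 <= C * l%:R `^ (1 - d%:R).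
Proof.
move=> hd; have [C C0 HC] := theta_even_exp_ge hd.
exists C%:R => [|l l0]; first by rewrite ltr0n.
set N := #|` _|.
have lN : (l ^ d.-1 <= C * N)%N.
  rewrite -lez_nat PoszM; apply: (le_trans (HC l.+1 l l0 (ltnSn l))).
  by rewrite ler_pM2l ?ltz_nat //; exact: card_zsphere2_ge.
have N0 : (0 < N)%N.
  by move: lN; case: (N) => //; rewrite muln0 leqn0 expn_eq0; case: (l) l0.
have -> : 1 - d%:R = - (d.-1)%:R :> R.
  by rewrite -{1}[d]prednK ?(leq_trans _ hd) // -natr1; ring.
rewrite powR_invn // -natrX ler_pdivlMr ?ltr0n ?expn_gt0 ?l0 //.
rewrite mulrC ler_pdivrMr ?ltr0n // -natrM ler_nat //.
Qed.

(** * Decomposition into dyadic blocks *)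

Lemma sum_pairs_by_level (R : pzRingType) (T : Type) (r : seq T) (q : T -> nat)
    (n : nat) (F G : T -> R) :
  \sum_(p <- pairs r | (q p.1 + q p.2 == n)%N) F p.1 * G p.2 =
  \sum_(0 <= l < n.+1)
    (\sum_(u <- r | (q u + l == n)%N) F u) * (\sum_(v <- r | q v == l) G v).
Proof.
have level_prod l :
    (\sum_(u <- r | (q u + l == n)%N) F u) * (\sum_(v <- r | q v == l) G v) =
    \sum_(u <- r) \sum_(v <- r)
      (if l == q v then (if (q u + q v == n)%N then F u * G v else 0) else 0).
  rewrite big_distrlr /= big_mkcond /=; apply: eq_bigr => u _.
  case: ifP => qul; last first.
    by rewrite big1 // => v _; case: eqP => // <-; rewrite qul.
  rewrite big_mkcond; apply: eq_bigr => v _.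
  by rewrite eq_sym; case: eqP => // <-; rewrite qul.
under [RHS]eq_bigr => l _ do rewrite level_prod.
rewrite exchange_big /= big_mkcond big_allpairs_dep; apply: eq_bigr => u _ /=.
rewrite exchange_big /=; apply: eq_bigr => v _.
rewrite -big_mkcond big_nat1_eq /=; case: ifP; last by rewrite if_same.
by move=> /eqP <-; rewrite ltnS leq_addl.
Qed.

(** For each u at most one level l satisfies q u + l = n, and l >= 2^k in the
    k-th block. *)
Lemma sum_dyadic_levels_le (R : numDomainType) (T : Type) (r : seq T)
    (q : T -> nat) (n k : nat) (F : T -> R) : (forall u, 0 <= F u) ->
  \sum_(1 <= l < n.+1 | trunc_log 2 l == k)
    \sum_(u <- r | (q u + l == n)%N) F u <=
  \sum_(u <- r | (q u <= n - 2 ^ k)%N) F u.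
Proof.
move=> F0; under eq_bigr => l _ do rewrite big_mkcond.
rewrite exchange_big /= [leRHS]big_mkcond; apply: ler_sum => u _.
pose c := if (q u <= n - 2 ^ k)%N then F u else 0.
have c0 : 0 <= c by rewrite /c; case: ifP.
apply: (@le_trans _ _ (\sum_(1 <= l < n.+1 | (l == n - q u)%N) c)); last first.
  by rewrite big_nat1_eq; case: ifP.
rewrite big_mkcond [leRHS]big_mkcond; apply: ler_sum_nat => l /andP[l0 _].
case: eqP => [logl|_]; last by case: ifP.
have /andP[lel _] := @trunc_log_bounds 2 l isT l0; rewrite logl in lel.
case: eqP => [qul|_]; last by case: ifP.
by rewrite -qul addKn eqxx /c leq_subRL ?ifT //; lia.
Qed.

Lemma sum_by_dyadic_block (R : nmodType) (n : nat) (A : nat -> R) :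
  \sum_(1 <= l < n.+1) A l =
  \sum_(0 <= k < (trunc_log 2 n).+1)
    \sum_(1 <= l < n.+1 | trunc_log 2 l == k) A l.
Proof.
under [RHS]eq_bigr => k _ do rewrite big_mkcond.
rewrite exchange_big /= !big_nat; apply: eq_bigr => l /andP[l0 ltl].
rewrite -big_mkcond (eq_bigl (fun k => k == trunc_log 2 l)) => [|k]; last first.
  by rewrite eq_sym.
by rewrite big_nat1_eq /= ltnS leq_trunc_log.
Qed.

Lemma sphere_sum_ge0 (R : realType) d (g : Zd d -> R) x l :
  (forall y, 0 <= g y) -> 0 <= \sum_(v \in @zsphere R d l) g (x - v).
Proof. by move=> g0; apply: fsumr_ge0 => v _. Qed.

(** A supremum in the reals dominates a set only if this set is bounded; here
    the sum over the finitely many levels below 2 Lambda is an upper bound. *)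
Lemma sphere_avg_le_dyadic_max (R : realType) d (g : Zd d -> R) x l Lambda :
    (forall y, 0 <= g y) -> (0 < l)%N -> (Lambda <= l < 2 * Lambda)%N ->
  l%:R `^ (1 - d%:R / 2) * (\sum_(v \in @zsphere R d l) g (x - v)) <=
  dyadic_max_sphere Lambda g x.
Proof.
move=> g0 l0 lL; rewrite /dyadic_max_sphere.
set h := fun l : nat => l%:R `^ (1 - d%:R / 2) * (\sum_(v \in @zsphere R d l) g (x - v)).
have h0 m : 0 <= h m by rewrite mulr_ge0 ?powR_ge0 ?sphere_sum_ge0.
apply: ub_le_sup; last by exists l.
exists (\sum_(m < 2 * Lambda) h m) => _ [m [m0 /andP[_ ltm]] <-].
by rewrite (bigD1 (Ordinal ltm)) //= lerDl sumr_ge0.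
Qed.

Lemma dyadic_max_sphere_ge0 (R : realType) d (g : Zd d -> R) x Lambda :
    (forall y, 0 <= g y) -> (0 < Lambda)%N ->
  0 <= dyadic_max_sphere Lambda g x.
Proof.
move=> g0 L0; apply: le_trans (sphere_avg_le_dyadic_max x g0 L0 _).
  by rewrite mulr_ge0 ?powR_ge0 ?sphere_sum_ge0.
by rewrite leqnn -[ltnLHS]mul1n ltn_pmul2r.
Qed.

(** The factor 2^(d/2-1) accounts for the replacement of l by the lower end of
    its dyadic block; it needs the exponent d/2 - 1 to be nonnegative. *)
Lemma sphere_sum_le_dyadic_max (R : realType) d (g : Zd d -> R) x l :
    (forall y, 0 <= g y) -> (2 <= d)%N -> (0 < l)%N ->
  \sum_(v \in @zsphere R d l) g (x - v) <=
  2 `^ (d%:R / 2 - 1) * ((2 ^+ trunc_log 2 l) `^ (d%:R / 2 - 1)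
    * dyadic_max_sphere (2 ^ trunc_log 2 l) g x).
Proof.
move=> g0 hd l0; set k := trunc_log 2 l; set a := d%:R / 2 - 1 : R.
have /andP[kl lk] := @trunc_log_bounds 2 l isT l0.
have a0 : 0 <= a by rewrite subr_ge0 ler_pdivlMr // mul1r ler_nat.
have lR : 0 < l%:R :> R by rewrite ltr0n.
have -> : \sum_(v \in @zsphere R d l) g (x - v) =
    l%:R `^ a * (l%:R `^ (1 - d%:R / 2) * (\sum_(v \in @zsphere R d l) g (x - v))).
  rewrite mulrA -powRD; last by rewrite (gt_eqF lR) implybT.
  by rewrite /a addrA subrK subrr powRr0 mul1r.
rewrite [leRHS]mulrA -powRM ?exprn_ge0 // -exprS; apply: ler_pM.
- exact: powR_ge0.
- by rewrite mulr_ge0 ?powR_ge0 ?sphere_sum_ge0.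
- apply: ge0_ler_powR; rewrite ?nnegrE ?exprn_ge0 //.
  by rewrite -natrX ler_nat ltnW.
by apply: sphere_avg_le_dyadic_max => //; rewrite kl -expnS.
Qed.

Lemma ball_avg_ge0 (R : realType) d (f : Zd d -> R) x m :
  (forall y, 0 <= f y) -> 0 <= ball_avg m f x.
Proof. by move=> f0; rewrite mulr_ge0 ?invr_ge0 // fsumr_ge0. Qed.

Lemma ball_sum_le (R : realType) d (f : Zd d -> R) x m :
  (forall y, 0 <= f y) ->
  \sum_(u \in @zball R d m) f (x - u) <= 3 ^+ d * ball_weight R d m * ball_avg m f x.
Proof.
move=> f0; have -> : \sum_(u \in @zball R d m) f (x - u) =
    (#|` fset_set (@zball R d m)|)%:R * ball_avg m f x.
  by rewrite mulrA divff ?mul1r // pnatr_eq0 -lt0n card_zball_gt0.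
by rewrite ler_wpM2r ?ball_avg_ge0 ?card_zball_le.
Qed.

Theorem theorem1 (R : realType) (d : nat) (hd : (3 <= d)%N) :
  exists2 C : R, 0 < C &
    forall (lambda : nat) (hlambda : (0 < lambda)%N) (f g : Zd d -> R)
      (hf : forall y, 0 <= f y) (hg : forall y, 0 <= g y) (x : Zd d),
      bilinear_sphere_avg lambda f g x <=
        C * (lambda%:R `^ (1 - d%:R / 2) * ball_avg lambda f x * g x
             + lambda%:R `^ (1 - d%:R) *
               \sum_(0 <= k < (trunc_log 2 lambda).+1)
                 ((2 ^+ k) `^ (d%:R / 2 - 1)
                  * ball_weight R d (lambda - 2 ^ k)
                  * ball_avg (lambda - 2 ^ k) f x
                  * dyadic_max_sphere (2 ^ k) g x)).
Proof.
have [C C0 cardN] := card_zsphere2_powR R hd.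
set a := d%:R / 2 - 1 : R.
exists (C * (3 ^+ d * (1 + 2 `^ a))) => [|n n0 f g f0 g0 x].
  by rewrite !mulr_gt0 ?exprn_gt0 // ltr_wpDr ?powR_ge0.
(* All points u and v that occur lie in one finite list, so that the sums over
   spheres and smaller balls become filtered sums over this list. *)
set B : seq (Zd d) := fset_set (@zball R d n).
have uB : uniq B by exact: fset_uniq.
have memB u : (u \in B) = (sqnorm u <= n)%N.
  rewrite in_fset_set; last exact: zball_finite.
  by apply/idP/idP => [/set_mem/zballE|/zballE/mem_set].
have ballE m : (m <= n)%N ->
    \sum_(u <- B | (sqnorm u <= m)%N) f (x - u) = \sum_(u \in @zball R d m) f (x - u).
  move=> lemn; rewrite (fsbig_seq_filter _ uB (P := fun u => (sqnorm u <= m)%N)) // => u.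
  by split=> [/zballE um|[_ /zballE]//]; rewrite memB (leq_trans um lemn).
have sphereE l : (l <= n)%N ->
    \sum_(v <- B | sqnorm v == l) g (x - v) = \sum_(v \in @zsphere R d l) g (x - v).
  move=> leln; rewrite (fsbig_seq_filter _ uB (P := fun v => sqnorm v == l)) // => v.
  by split=> [/zsphereE vl|[_ /zsphereE]//]; rewrite memB (eqP vl).
(* The only lattice point of square norm 0 is the origin. *)
have centerE : \sum_(v <- B | sqnorm v == 0) g (x - v) = g x.
  rewrite sphereE // (@fsbig_seq_filter _ _ _ [:: 0] (fun v => sqnorm v == 0)) // => [|v].
    by rewrite big_mkcond big_seq1 /sqnorm big1 ?eqxx ?subr0 // => i _; rewrite mxE.
  split=> [/zsphereE v0|[_ /zsphereE]//]; split=> //; rewrite inE; apply/eqP/rowP => i.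
  move: v0; rewrite /sqnorm sum_nat_eq0 mxE => /forallP/(_ i)/=.
  by rewrite expn_eq0 andbT absz_eq0 => /eqP.
pose S k : R := (2 ^+ k) `^ a * ball_weight R d (n - 2 ^ k)
  * ball_avg (n - 2 ^ k) f x * dyadic_max_sphere (2 ^ k) g x.
have total : \sum_(w \in @zsphere2 R d n) (f (x - w.1) * g (x - w.2)) <=
    3 ^+ d * (n%:R `^ (d%:R / 2) * ball_avg n f x * g x) +
    3 ^+ d * 2 `^ a * \sum_(0 <= k < (trunc_log 2 n).+1) S k.
  rewrite (@fsbig_seq_filter _ _ _ (pairs B)
    (fun w => (sqnorm w.1 + sqnorm w.2 == n)%N)) ?uniq_pairs //; last first.
    move=> [u v]; rewrite mem_pairs !memB; split=> [/zsphere2E/= uv|[_ /zsphere2E]//].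
    by split=> //; rewrite -(eqP uv) leq_addr leq_addl.
  rewrite (sum_pairs_by_level B (@sqnorm d) n (fun u => f (x - u)) (fun v => g (x - v))).
  (* Level 0 is the center v = 0; the other levels form the dyadic blocks. *)
  rewrite big_ltn // centerE; apply: lerD.
    rewrite 2!mulrA ler_wpM2r //.
    have -> : n%:R `^ (d%:R / 2) = ball_weight R d n :> R.
      by rewrite /ball_weight (maxn_idPl _).
    apply: le_trans (ball_sum_le x n f0).
    rewrite -ballE // big_mkcond [leRHS]big_mkcond; apply: ler_sum => u _ /=.
    by rewrite addn0; case: eqP => [->|_]; rewrite ?leqnn //; case: ifP.
  rewrite sum_by_dyadic_block mulr_sumr !big_nat; apply: ler_sum => k.
  move=> _.
  set Mk := dyadic_max_sphere (2 ^ k) g x.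
  have Mk0 : 0 <= Mk by apply: dyadic_max_sphere_ge0; rewrite ?expn_gt0.
  pose c := 2 `^ a * ((2 ^+ k) `^ a * Mk).
  have c0 : 0 <= c by rewrite !mulr_ge0 ?powR_ge0.
  apply: (@le_trans _ _ (\sum_(1 <= l < n.+1 | trunc_log 2 l == k)
      (\sum_(u <- B | (sqnorm u + l == n)%N) f (x - u)) * c)).
    rewrite big_nat_cond [leRHS]big_nat_cond; apply: ler_sum => l.
    move=> /andP[/andP[l0 ln] /eqP logl]; rewrite ler_wpM2l ?sumr_ge0 //.
    rewrite sphereE // /c /Mk -logl; apply: sphere_sum_le_dyadic_max => //.
    exact: ltnW.
  rewrite -mulr_suml.
  have -> : 3 ^+ d * 2 `^ a * S k =
      3 ^+ d * ball_weight R d (n - 2 ^ k) * ball_avg (n - 2 ^ k) f x * c.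
    by rewrite /S /c /Mk; ring.
  rewrite ler_wpM2r // (le_trans _ (ball_sum_le x _ f0)) // -ballE ?leq_subr //.
  by apply: sum_dyadic_levels_le => u.
have S0 : 0 <= \sum_(0 <= k < (trunc_log 2 n).+1) S k.
  apply: sumr_ge0 => k _; rewrite /S /ball_weight.
  rewrite !mulr_ge0 ?powR_ge0 ?fsumr_ge0 //.
  by apply: dyadic_max_sphere_ge0; rewrite ?expn_gt0.
have X0 : 0 <= n%:R `^ (d%:R / 2) * ball_avg n f x * g x.
  by rewrite !mulr_ge0 ?powR_ge0 ?fsumr_ge0.
rewrite /bilinear_sphere_avg.
apply: (@le_trans _ _ (C * n%:R `^ (1 - d%:R) *
    (3 ^+ d * (n%:R `^ (d%:R / 2) * ball_avg n f x * g x) +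
     3 ^+ d * 2 `^ a * \sum_(0 <= k < (trunc_log 2 n).+1) S k))).
  apply: ler_pM => //; rewrite ?invr_ge0 ?cardN //.
  by apply: fsumr_ge0 => w _; rewrite mulr_ge0.
have -> : n%:R `^ (1 - d%:R / 2) = n%:R `^ (1 - d%:R) * n%:R `^ (d%:R / 2) :> R.
  rewrite -powRD; last by rewrite pnatr_eq0 -lt0n n0 implybT.
  by congr (_ `^ _); lra.
rewrite -(mulrA (n%:R `^ (1 - d%:R))) -(mulrA (n%:R `^ (1 - d%:R))).
move: (powR_ge0 (n%:R : R) (1 - d%:R)) (powR_ge0 (2 : R) a) X0 S0 C0.
have : 0 <= 3 ^+ d :> R by rewrite exprn_ge0.
set X := _ * g x; set Y := \sum_(_ <= _ < _) _.
move: (3 ^+ d) (n%:R `^ (1 - d%:R)) (2 `^ a) X Y => E P t X Y E0 P0 t0 X0 Y0 C0.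
have -> : C * (E * (1 + t)) * (P * X + P * Y) =
    C * P * (E * X + E * t * Y) + C * P * E * (t * X + Y) by ring.
by rewrite lerDl !mulr_ge0 ?addr_ge0 ?mulr_ge0 // ltW.
Qed.
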